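(* Let an increasing price function $P:\mathbb{N}_{\ge 1}\to\mathbb{R}_{\ge 0}$ be given. All zone tariffs with single counting with respect to $P$ (on all PTNs with zone partitions) satisfy the no-stopover property if and only if $P(k)\le P(i)+P(k-i+1)$ for all $k\in\mathbb{N}_{\ge 1}$ and $i\in\{1,\dots,k\}$.
   Context: ''Increasing'' means non-decreasing. A PTN is a finite, simple, connected, undirected graph $(V,E)$. A path is a finite sequence $(x_1,\dots,x_n)$, $n\ge 1$, of (not necessarily distinct) nodes with consecutive nodes adjacent; $\mathcal{W}$ is the set of all paths; $[x_i,x_j]$ denotes the subpath $(x_i,\dots,x_j)$. A zone partition $\mathcal{Z}$ is a partition of $V$ into nonempty sets called zones. For a path $W$, $\bar z(W)$ is the number of different zones containing at least one node of $W$. A fare structure $p:\mathcal{W}\to\mathbb{R}_{\ge 0}$ is a zone tariff with single counting with respect to $P$ if $p(W)=P(\bar z(W))$ for all $W\in\mathcal{W}$. No-stopover property: $p([x_1,x_n])\le p([x_1,x_i])+p([x_i,x_n])$ for all paths $(x_1,\dots,x_n)\in\mathcal{W}$, $n\ge 3$, and all $i\in\{2,\dots,n-1\}$. *)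

(* Defs.v *)
From HB Require Import structures.
From mathcomp Require Import all_boot all_order all_algebra.
From mathcomp Require Import reals.

Set Implicit Arguments.
Unset Strict Implicit.
Unset Printing Implicit Defensive.

Import Order.TTheory GRing.Theory Num.Theory.

Local Open Scope ring_scope.

(** The empty graph is not excluded; it has no walks. *)
Record ptn := Ptn {
  node :> finType;
  edge : rel node;
  edge_sym : symmetric edge;
  edge_irr : irreflexive edge;
  edge_conn : forall x y : node, connect edge x y
}.

(** The paths of the fare model, whose nodes may repeat.  [sorted] only
    requires consecutive elements to be related. *)
Definition is_walk (G : ptn) (s : seq G) : bool :=
  (0 < size s)%N && sorted (@edge G) s.

Record walk (G : ptn) := Walk {
  walk_seq :> seq G;
  walkP : is_walk walk_seq
}.

HB.instance Definition _ (G : ptn) := [isSub for @walk_seq G].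

(** [(x_i, ..., x_j)], with nodes numbered from 1.  The value [W] returned
    outside the range [1 <= i <= j <= size W] is a dummy; see [val_subwalk]. *)
Definition subwalk (G : ptn) (W : walk G) (i j : nat) : walk G :=
  insubd W (take (j - i).+1 (drop i.-1 W)).

Lemma val_subwalk (G : ptn) (W : walk G) (i j : nat) :
  (1 <= i <= j)%N -> (j <= size W)%N ->
  subwalk W i j = take (j - i).+1 (drop i.-1 W) :> seq G.
Proof.
move=> /andP[i1 ij] jW; rewrite /subwalk (val_insubd W) ifT //.
have /andP[_ sW] := walkP W.
apply/andP; split; last exact/take_sorted/drop_sorted.
rewrite size_take_min size_drop leq_min ltnS leq0n subn_gt0.
by rewrite prednK // (leq_trans ij jW).
Qed.

Definition zone_partition (G : ptn) (Z : {set {set G}}) : bool :=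
  partition Z [set: G].

Definition nzones (G : ptn) (Z : {set {set G}}) (W : walk G) : nat :=
  #|[set z in Z | [exists x in z, x \in walk_seq W]]|.

Definition fare_structure (R : realType) (G : ptn) (p : walk G -> R) : Prop :=
  forall W : walk G, 0 <= p W.

(** Price functions have domain [{1, 2, ...}]; the value at 0 is a dummy. *)
Definition price_function (R : realType) (P : nat -> R) : Prop :=
  forall k : nat, (1 <= k)%N -> 0 <= P k.

Definition increasing_price (R : realType) (P : nat -> R) : Prop :=
  forall k l : nat, (1 <= k)%N -> (k <= l)%N -> P k <= P l.

Definition zone_tariff_single (R : realType) (P : nat -> R) (G : ptn)
    (Z : {set {set G}}) (p : walk G -> R) : Prop :=
  fare_structure p /\ forall W : walk G, p W = P (nzones Z W).

Definition no_stopover (R : realType) (G : ptn) (p : walk G -> R) : Prop :=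
  forall (W : walk G) (i : nat),
    (3 <= size W)%N -> (2 <= i <= (size W).-1)%N ->
    p (subwalk W 1 (size W)) <= p (subwalk W 1 i) + p (subwalk W i (size W)).

(* Main.v *)
Require Import Defs.
From HB Require Import structures.
From mathcomp Require Import all_boot all_order all_algebra.
From mathcomp Require Import reals.

(** Cut a path with zone set [C] at an interior node [x]: the two pieces have
    zone sets [A] and [B] with union [C], and the zone of [x] lies in both, so
    [#|C| + 1 <= #|A| + #|B|].  With [k = #|C|] and [i = #|A|] this reads
    [k - i + 1 <= #|B|], and monotonicity turns the inequality for [(k, i)]
    into the no-stopover property ([card_zones_split]).

    Conversely, the bound is attained by a path that visits a new zone at each
    node: its pieces then meet exactly [i] and [k - i + 1] zones.  A complete
    graph on [k] nodes with singleton zones carries such a path, an enumeration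
    of its nodes ([complete_no_stopover]).  A node strictly inside the path
    corresponds to [1 < i < k]; for [i = 1] and [i = k] the inequality says
    only that [P 1] is nonnegative. *)

Set Implicit Arguments.
Unset Strict Implicit.
Unset Printing Implicit Defensive.

Import Order.TTheory GRing.Theory Num.Theory.

Local Open Scope ring_scope.

Lemma subwalk_prefix (G : ptn) (W : walk G) (i : nat) :
  (1 <= i <= size W)%N -> subwalk W 1 i = take i W :> seq G.
Proof.
move=> /andP[i1 iW]; rewrite val_subwalk ?i1 //= drop0.
by rewrite subn1 prednK.
Qed.

Lemma subwalk_suffix (G : ptn) (W : walk G) (i : nat) :
  (1 <= i <= size W)%N -> subwalk W i (size W) = drop i.-1 W :> seq G.
Proof.
move=> /andP[i1 iW]; rewrite val_subwalk ?i1 //= take_oversize // size_drop.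
by rewrite -subSn // -subSS prednK.
Qed.

Lemma subwalk_full (G : ptn) (W : walk G) : subwalk W 1 (size W) = W.
Proof.
have W0 : (0 < size W)%N by have /andP[] := walkP W.
by apply: val_inj; rewrite /= subwalk_prefix ?W0 ?leqnn // take_size.
Qed.

(** On sequences rather than walks, so that [take] and [drop] apply. *)
Definition zones_met (T : finType) (Z : {set {set T}}) (s : seq T) :
    {set {set T}} :=
  [set z in Z | [exists x in z, x \in s]].

Lemma zones_metP (T : finType) (Z : {set {set T}}) (s : seq T) (z : {set T}) :
  reflect (z \in Z /\ exists2 x, x \in z & x \in s) (z \in zones_met Z s).
Proof.
rewrite inE; apply: (iffP andP) => [[zZ /exists_inP]|[zZ ?]] //.
by split=> //; apply/exists_inP.
Qed.

Lemma zones_met_sub (T : finType) (Z : {set {set T}}) (s t : seq T) :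
  {subset s <= t} -> zones_met Z s \subset zones_met Z t.
Proof.
move=> st; apply/subsetP => z /zones_metP[zZ [x xz xs]].
by apply/zones_metP; split=> //; exists x => //; apply: st.
Qed.

Lemma zones_met_cat (T : finType) (Z : {set {set T}}) (s t : seq T) :
  zones_met Z (s ++ t) = zones_met Z s :|: zones_met Z t.
Proof.
apply/setP => z; rewrite in_setU.
apply/zones_metP/orP => [[zZ [x xz]]|[]/zones_metP[zZ [x xz xst]]].
- by rewrite mem_cat => /orP[]?; [left|right];
    apply/zones_metP; split=> //; exists x.
- by split=> //; exists x => //; rewrite mem_cat xst.
- by split=> //; exists x => //; rewrite mem_cat xst orbT.
Qed.

Lemma pblock_zones_met (T : finType) (Z : {set {set T}}) (s : seq T) (x : T) :
  partition Z [set: T] -> x \in s -> pblock Z x \in zones_met Z s.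
Proof.
move=> /and3P[/eqP covZ _ _] xs.
have xcov : x \in cover Z by rewrite covZ inE.
apply/zones_metP; split; first exact: pblock_mem.
by exists x; rewrite ?mem_pblock.
Qed.

Lemma nzonesE (G : ptn) (Z : {set {set G}}) (W : walk G) :
  nzones Z W = #|zones_met Z W|.
Proof. by []. Qed.

(** The zone of the node [x] where the two pieces are joined is counted in
    both, whence the extra 1. *)
Lemma card_zones_split (T : finType) (Z : {set {set T}}) (s t : seq T) (x : T) :
  partition Z [set: T] -> x \in s -> x \in t ->
  (#|zones_met Z (s ++ t)| < #|zones_met Z s| + #|zones_met Z t|)%N.
Proof.
move=> partZ xs xt; rewrite zones_met_cat -cardsUI -[X in (X < _)%N]addn0.
rewrite ltn_add2l card_gt0; apply/set0Pn; exists (pblock Z x).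
by rewrite inE !pblock_zones_met.
Qed.

Lemma zone_tariff_no_stopover (R : realType) (P : nat -> R) (G : ptn)
    (Z : {set {set G}}) (p : walk G -> R) :
  increasing_price P ->
  (forall k i : nat, (1 <= k)%N -> (1 <= i <= k)%N ->
    P k <= P i + P (k - i + 1)%N) ->
  zone_partition Z -> zone_tariff_single P Z p -> no_stopover p.
Proof.
move=> P_incr P_sub partZ [_ pE] W i W3 /andP[i2 iW].
have i1 : (0 < i)%N by apply: ltnW.
have iltW : (i < size W)%N by rewrite -(ltn_predK W3).
have iW' : (1 <= i <= size W)%N by rewrite i1 ltnW.
rewrite subwalk_full !pE !nzonesE subwalk_prefix // subwalk_suffix //.
(* the node x_i, at position i.-1 of the sequence *)
have /hasP[x _ _] : has predT W by rewrite has_predT (leq_ltn_trans _ iltW).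
pose y := nth x W i.-1.
have ypre : y \in take i W.
  by rewrite /y -(@nth_take i) ?prednK // mem_nth // size_take iltW prednK.
have ysuf : y \in drop i.-1 W.
  rewrite /y -[X in nth _ _ X]addn0 -nth_drop mem_nth // size_drop subn_gt0.
  by rewrite prednK // ltnW.
have subA : (#|zones_met Z (take i W)| <= #|zones_met Z W|)%N.
  by apply/subset_leq_card/zones_met_sub => u /mem_take.
have posA : (0 < #|zones_met Z (take i W)|)%N.
  by apply/card_gt0P; exists (pblock Z y); apply: pblock_zones_met.
(* the two pieces share the node x_i, so their concatenation is not W *)
have subC : (#|zones_met Z W| <=
    #|zones_met Z (take i W ++ drop i.-1 W)|)%N.
  apply/subset_leq_card/zones_met_sub => u.
  have dropS : drop 1 (drop i.-1 W) = drop i W by rewrite drop_drop add1n prednK.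
  rewrite -{1}(cat_take_drop i W) -dropS !mem_cat => /orP[->//|/mem_drop->].
  by rewrite orbT.
have := leq_ltn_trans subC (card_zones_split partZ ypre ysuf).
set a := #|zones_met Z (take i W)| in subA posA *.
set b := #|zones_met Z (drop _ W)|; set c := #|zones_met Z W| in subA *.
move=> ltc; apply: le_trans (P_sub c a _ _) _.
- exact: leq_trans subA.
- by rewrite posA.
rewrite lerD2l; apply: P_incr; first by rewrite addn1.
by rewrite addn1 ltn_subLR.
Qed.

Section CompleteNetwork.
Variable T : finType.

Lemma neq_sym : symmetric [rel x y : T | x != y].
Proof. by move=> x y; rewrite /= eq_sym. Qed.

Lemma neq_irr : irreflexive [rel x y : T | x != y].
Proof. by move=> x; rewrite /= eqxx. Qed.

Lemma neq_conn (x y : T) : connect [rel x y : T | x != y] x y.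
Proof. by have [->|xy] := eqVneq x y; [|apply: connect1]. Qed.

(** Completeness makes every repetition-free sequence of nodes a path, and
    connectedness immediate. *)
Definition complete_ptn : ptn := Ptn neq_sym neq_irr neq_conn.

Definition singleton_zones : {set {set complete_ptn}} :=
  [set [set x] | x : complete_ptn].

Lemma singleton_zones_partition : zone_partition singleton_zones.
Proof.
apply/and3P; split.
- apply/eqP/setP => x; rewrite inE; apply/bigcupP.
  by exists [set x]; rewrite ?set11 ?imset_f.
- apply/trivIsetP => _ _ /imsetP[x _ ->] /imsetP[y _ ->] xy.
  by rewrite disjoints1 inE; apply: contra_neq xy => ->.
- by apply/imsetP => -[x _ /setP/(_ x)]; rewrite !inE eqxx.
Qed.

Lemma card_singleton_zones_met (s : seq complete_ptn) :
  uniq s -> #|zones_met singleton_zones s| = size s.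
Proof.
move=> /card_uniqP <-.
rewrite -(card_imset _ (@set1_inj complete_ptn)); apply: eq_card => z.
apply/zones_metP/imsetP => [[/imsetP[x _ ->] [y /set1P-> xs]]|[x xs ->]].
  by exists x.
by split; [exact: imset_f | exists x; rewrite ?set11].
Qed.

Lemma uniq_is_walk (s : seq complete_ptn) :
  (0 < size s)%N -> uniq s -> is_walk s.
Proof.
move=> s0 us; rewrite /is_walk s0; apply: pairwise_sorted.
by rewrite -uniq_pairwise.
Qed.

End CompleteNetwork.

Lemma complete_no_stopover (R : realType) (P : nat -> R) (k i : nat) :
  price_function P ->
  (forall (G : ptn) (Z : {set {set G}}) (p : walk G -> R),
    zone_partition Z -> zone_tariff_single P Z p -> no_stopover p) ->
  (1 < i < k)%N -> P k <= P i + P (k - i + 1)%N.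
Proof.
move=> P_price nostop /andP[i1 ik].
pose G := complete_ptn 'I_k; pose Z := singleton_zones 'I_k.
have k2 : (2 < k)%N by apply: leq_ltn_trans ik.
have sizeE : size (enum 'I_k) = k by rewrite size_enum_ord.
have Ewalk : is_walk (enum 'I_k : seq G).
  by apply: uniq_is_walk (enum_uniq _); rewrite sizeE (ltn_trans _ k2).
pose W : walk G := Walk Ewalk.
have WE : size W = k by [].
have tariff : zone_tariff_single P Z (fun W => P (nzones Z W)).
  split=> // V; apply: P_price; rewrite nzonesE.
  have /andP[V0 _] := walkP V.
  have /hasP[x xV _] : has predT V by rewrite has_predT.
  apply/card_gt0P; exists (pblock Z x).
  by apply: pblock_zones_met xV; apply: singleton_zones_partition.
have := nostop G Z _ (singleton_zones_partition 'I_k) tariff W i.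
rewrite subwalk_full !nzonesE subwalk_prefix ?subwalk_suffix; last 2 first.
- by rewrite WE ltnW // ltnW.
- by rewrite WE ltnW // ltnW.
rewrite !card_singleton_zones_met ?take_uniq ?drop_uniq ?enum_uniq //.
rewrite size_take size_drop WE ik => /(_ k2).
(* the suffix starts at the i-th node, hence has k - i.-1 = k - i + 1 nodes *)
have -> : (k - i.-1 = k - i + 1)%N.
  by rewrite addn1 -subSn 1?ltnW // -[i in RHS](ltn_predK i1) subSS.
by apply; rewrite i1 -ltnS (ltn_predK k2).
Qed.

Theorem theorem41 (R : realType) (P : nat -> R)
    (P_price : price_function P) (P_incr : increasing_price P) :
  (forall (G : ptn) (Z : {set {set G}}) (p : walk G -> R),
      zone_partition Z -> zone_tariff_single P Z p -> no_stopover p) <->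
  (forall k i : nat, (1 <= k)%N -> (1 <= i <= k)%N ->
      P k <= P i + P (k - i + 1)%N).
Proof.
split=> [nostop k i k1 /andP[i1 ik] | P_sub G Z p]; last first.
  exact: zone_tariff_no_stopover.
have [i_gt1 | i_le1] := ltnP 1 i; last first.
  have -> : i = 1%N by apply/eqP; rewrite eqn_leq i_le1.
  by rewrite subnK // lerDr P_price.
have [i_ltk | k_lei] := ltnP i k.
  by apply: complete_no_stopover; rewrite ?i_gt1.
have -> : i = k by apply/eqP; rewrite eqn_leq ik.
by rewrite subnn lerDl P_price.
Qed.
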